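(* Each infinite artinian local ring is a $u$-ring.
   Context: All rings are commutative with $1\neq 0$. Local means having a unique maximal ideal. An ideal $I$ of a ring $R$ is a $u$-ideal if whenever $J_1,\ldots,J_n$ are finitely many ideals of $R$ with $I\subseteq\bigcup_{k=1}^n J_k$, then $I\subseteq J_k$ for some $k$. A ring $R$ is a $u$-ring if every ideal of $R$ is a $u$-ideal. *)

(* Defs.v *)
From mathcomp Require Import all_boot all_algebra.
From mathcomp Require Import all_classical.
Set Implicit Arguments.
Unset Strict Implicit.
Unset Printing Implicit Defensive.
Import GRing.Theory.
Local Open Scope classical_set_scope.
Local Open Scope ring_scope.

(* MathComp's [idealr] only describes proper ideals given by boolean
   predicates; here ideals are arbitrary subsets and may be the whole ring. *)
Definition is_ideal (R : comNzRingType) (I : set R) : Prop :=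
  [/\ I 0,
      forall x y, I x -> I y -> I (x + y) &
      forall a x, I x -> I (a * x)].

Definition maximal_ideal (R : comNzRingType) (M : set R) : Prop :=
  [/\ is_ideal M, M <> setT &
      forall J : set R, is_ideal J -> M `<=` J -> J = M \/ J = setT].

Definition local_ring (R : comNzRingType) : Prop :=
  exists! M : set R, maximal_ideal M.

(* Descending chain condition on ideals. *)
Definition artinian_ring (R : comNzRingType) : Prop :=
  forall J : nat -> set R,
    (forall n, is_ideal (J n)) ->
    (forall n, J n.+1 `<=` J n) ->
    exists N : nat, forall n, (N <= n)%N -> J n = J N.

Definition u_ideal (R : comNzRingType) (I : set R) : Prop :=
  forall (n : nat) (J : 'I_n -> set R),
    (forall k, is_ideal (J k)) ->
    I `<=` \bigcup_k J k ->
    exists k, I `<=` J k.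

Definition u_ring (R : comNzRingType) : Prop :=
  forall I : set R, is_ideal I -> u_ideal I.

(* Main.v *)
Require Import Defs.
From mathcomp Require Import all_boot all_algebra.
From mathcomp Require Import all_classical.
From mathcomp Require Import ring.

(** In a local ring with infinite residue field, an ideal [I] contained in none
    of finitely many ideals [J k] is not covered by them either. The argument is
    the one for vector spaces over an infinite field: if [x] in [I] avoids all
    the earlier ideals and [y] in [I] avoids the new one, then on the line
    [y + u * x] each [J k] contains points for at most one residue class of
    [u], so some [u] avoids them all ([avoid_finitely_many_ideals]).

    What remains is that an infinite artinian local ring has an infinite residue
    field ([residue_field_infinite]). This is usually deduced from the fact that
    artinian rings are noetherian, but the descending chain condition alone
    suffices. Let [M] be the maximal ideal and let [I] be minimal among the
    infinite ideals. For [a] in [M], which is nilpotent, [a I] is a proper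
    subideal of [I] and hence finite; then the kernel of multiplication by [a]
    on [I] is infinite, hence all of [I]. So [M] kills [I], which makes [I] a
    vector space over the residue field. If the latter were finite, each line
    [R x] in [I] would be finite, and a complement of a line would be an
    infinite ideal strictly smaller than [I]. *)

Set Implicit Arguments.
Unset Strict Implicit.
Unset Printing Implicit Defensive.
Import GRing.Theory.
Local Open Scope classical_set_scope.
Local Open Scope ring_scope.

Section Ideals.
Variable R : comNzRingType.
Implicit Types (I J K L M : set R) (a r x y : R).

Lemma ideal0 I : is_ideal I -> I 0.
Proof. by case. Qed.

Lemma idealD I x y : is_ideal I -> I x -> I y -> I (x + y).
Proof. by case=> _ addI _; apply: addI. Qed.

Lemma idealM I a x : is_ideal I -> I x -> I (a * x).
Proof. by case=> _ _ mulI; apply: mulI. Qed.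

Lemma idealB I x y : is_ideal I -> I x -> I y -> I (x - y).
Proof.
move=> Iid Ix Iy; rewrite -mulN1r.
by apply: idealD => //; apply: idealM.
Qed.

Lemma ideal_zero : is_ideal [set 0 : R].
Proof.
split=> // [x y -> -> | a x ->] /=; first by rewrite addr0.
by rewrite mulr0.
Qed.

Lemma ideal_full : is_ideal [set: R].
Proof. by []. Qed.

Lemma idealI I J : is_ideal I -> is_ideal J -> is_ideal (I `&` J).
Proof.
move=> Iid Jid; split; first by split; apply: ideal0.
- by move=> x y [Ix Jx] [Iy Jy]; split; apply: idealD.
- by move=> a x [Ix Jx]; split; apply: idealM.
Qed.

Lemma ideal_scale a I : is_ideal I -> is_ideal [set a * x | x in I].
Proof.
move=> Iid; split; first by exists 0; [exact: ideal0 | rewrite mulr0].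
- move=> _ _ [x Ix <-] [y Iy <-]; exists (x + y); first exact: idealD.
  by rewrite mulrDr.
- by move=> b _ [x Ix <-]; exists (b * x); [exact: idealM | ring].
Qed.

Lemma ideal_adjoin I y : is_ideal I -> is_ideal [set x | exists r, I (x - r * y)].
Proof.
move=> Iid; split; first by exists 0; rewrite mul0r subr0; apply: ideal0.
- move=> x x' [r Ir] [r' Ir']; exists (r + r').
  have -> : x + x' - (r + r') * y = (x - r * y) + (x' - r' * y) by ring.
  exact: idealD.
- move=> a x [r Ir]; exists (a * r).
  have -> : a * x - a * r * y = a * (x - r * y) by ring.
  exact: idealM.
Qed.

Lemma ideal_annihilated a I :
  is_ideal I -> is_ideal [set x | I x /\ a * x = 0].
Proof.
move=> Iid; split; first by split; [exact: ideal0 | rewrite mulr0].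
- move=> x y [Ix ax0] [Iy ay0]; split; first exact: idealD.
  by rewrite mulrDr ax0 ay0 addr0.
- move=> b x [Ix ax0]; split; first exact: idealM.
  by rewrite mulrCA ax0 mulr0.
Qed.

Lemma ideal_contains1 I : is_ideal I -> I 1 -> I = setT.
Proof.
move=> Iid I1; apply/seteqP; split=> // x _.
by rewrite -[x]mulr1; apply: idealM.
Qed.

(** This serves twice: with [x = 1] it produces maximal ideals, and with [x] in
    an ideal killed by the maximal ideal it produces a complement of the line
    spanned by [x]. *)
Lemma exists_ideal_maximal_avoiding K x : is_ideal K -> ~ K x ->
  exists L, [/\ is_ideal L, K `<=` L, ~ L x &
    forall y, ~ L y -> exists r, L (x - r * y)].
Proof.
move=> Kid Kx.
(* Zorn's lemma is applied to the sets [X] such that [K `|` X] is an ideal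
   avoiding [x], because the empty chain has an empty union. *)
pose P : set (set R) := [set X | is_ideal (K `|` X) /\ ~ (K `|` X) x].
have [|A [[Lid Lx] Amax]] := @Zorn_bigcup R P.
  move=> F FP Ftot.
  have in_member X a : F X -> (K `|` X) a -> (K `|` \bigcup_(Y in F) Y) a.
    by move=> FX [|Xa]; [left | right; exists X].
  split; last by case=> // -[X FX Xx]; case: (FP X FX) => _; apply; right.
  split; first by left; apply: ideal0.
  - move=> a b [Ka|[X FX Xa]] [Kb|[Y FY Yb]].
    + by left; apply: idealD.
    + by apply: (in_member Y) => //; apply: idealD; [case: (FP Y FY) | left | right].
    + by apply: (in_member X) => //; apply: idealD; [case: (FP X FX) | right | left].
    + case: (Ftot X Y FX FY) => sub.
        by apply: (in_member Y) => //; apply: idealD;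
           [case: (FP Y FY) | right; apply: sub | right].
      by apply: (in_member X) => //; apply: idealD;
         [case: (FP X FX) | right | right; apply: sub].
  - move=> a b [Kb|[X FX Xb]]; first by left; apply: idealM.
    by apply: (in_member X) => //; apply: idealM; [case: (FP X FX) | right].
exists (K `|` A); split=> // y Ly.
apply: contrapT => no_r.
pose B := [set z | exists r, (K `|` A) (z - r * y)].
have sAB : K `|` A `<=` B by move=> z Lz; exists 0; rewrite mul0r subr0.
have KB : K `|` B = B by apply/setUidPr => z Kz; apply: sAB; left.
apply: (Amax B).
  split; first by move=> z Az; apply: sAB; right.
  move=> sBA; apply: Ly; right; apply: sBA.
  by exists 1; rewrite mul1r subrr; apply: ideal0.
by split; rewrite KB //; apply: ideal_adjoin.
Qed.

Lemma maximal_ideal_proper M : maximal_ideal M -> ~ M 1.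
Proof. by case=> Mid MnT _ /(ideal_contains1 Mid). Qed.

Lemma unit_outside_unique_maximal_ideal M a :
  (forall M', maximal_ideal M' -> M = M') -> ~ M a -> exists v, v * a = 1.
Proof.
move=> Muniq Ma; apply: contrapT => nonunit.
have aRid := ideal_scale a ideal_full.
have [|L [Lid sL L1 Lmax]] := exists_ideal_maximal_avoiding aRid (x := 1).
  by case=> v _ av; apply: nonunit; exists v; rewrite mulrC.
apply: Ma; rewrite (Muniq L); first by apply: sL; exists 1; rewrite ?mulr1.
split => // [LT | J Jid sLJ]; first by apply: L1; rewrite LT.
have [sJL | /existsNP[y /not_implyP[Jy Ly]]] := pselect (J `<=` L).
  by left; apply/seteqP.
right; apply: ideal_contains1 => //.
have [r Lr] := Lmax y Ly.
rewrite -[1](subrK (r * y)); apply: idealD => //; first exact: sLJ.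
exact: idealM.
Qed.

Lemma artinian_minimal_ideal (P : set R -> Prop) I :
  artinian_ring R -> is_ideal I -> P I ->
  exists J, [/\ is_ideal J, P J &
    forall K, is_ideal K -> K `<=` J -> P K -> K = J].
Proof.
move=> art Iid PI; apply: contrapT => nomin.
pose X := {J : set R | is_ideal J /\ P J}.
pose desc (J K : X) := sval K `<=` sval J /\ sval K <> sval J.
have step (J : X) : {K : X | desc J K}.
  apply: cid; apply: contrapT => noK; apply: nomin.
  case: J noK => J [Jid PJ] noK; exists J; split=> // K Kid sKJ PK.
  by apply: contrapT => KJ; apply: noK; exists (exist _ K (conj Kid PK)).
have [f [_ fdesc]] := dependent_choice step (exist _ I (conj Iid PI)).
have [|n|N stat] := art (fun n => sval (f n)).
- by move=> n; case: (svalP (f n)).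
- by case: (fdesc n).
- by case: (fdesc N) => _; apply; apply: stat.
Qed.

(** The chain of the [a ^+ n R] stabilizes, so [a ^+ n = r * a ^+ n.+1] for some
    [n] and [r], and [1 - r * a] is a unit. *)
Lemma artinian_local_nilpotent M a : artinian_ring R -> maximal_ideal M ->
  (forall M', maximal_ideal M' -> M = M') -> M a -> exists n, a ^+ n = 0.
Proof.
move=> art Mmax Muniq Ma.
have [|n|N stat] := art (fun n => [set a ^+ n * x | x in setT]).
- by move=> n; apply: ideal_scale.
- by move=> _ [x _ <-]; exists (a * x) => //; rewrite exprSr mulrA.
exists N.
have : [set a ^+ N * x | x in setT] (a ^+ N) by exists 1; rewrite ?mulr1.
rewrite -(stat N.+1) // => -[r _ aN].
have [|v v1] := @unit_outside_unique_maximal_ideal M (1 - r * a) Muniq.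
  move=> Mra; apply: (maximal_ideal_proper Mmax).
  have [Mid _ _] := Mmax.
  by rewrite -[1](subrK (r * a)); apply: idealD => //; apply: idealM.
rewrite -[LHS]mul1r -v1.
have -> : v * (1 - r * a) * a ^+ N = v * (a ^+ N - a ^+ N.+1 * r).
  by rewrite exprS; ring.
by rewrite aN subrr mulr0.
Qed.

(** The fibres of multiplication by [a] on [I] are translates of its kernel. *)
Lemma infinite_annihilated a I : is_ideal I -> infinite_set I ->
  finite_set [set a * x | x in I] -> infinite_set [set x | I x /\ a * x = 0].
Proof.
move=> Iid Iinf aIfin Kfin; apply: Iinf.
have /choice[g gP] (y : R) :
    exists x, [set a * x | x in I] y -> I x /\ a * x = y.
  have [[x Ix <-]|] := pselect ([set a * x | x in I] y); last by exists 0.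
  by exists x.
apply: sub_finite_set (finite_image2 (fun y k => g y + k) aIfin Kfin) => x Ix.
have aIx : [set a * x | x in I] (a * x) by exists x.
have [Ig ag] := gP _ aIx.
exists (a * x) => //; exists (x - g (a * x)); last by rewrite addrC subrK.
by split; [exact: idealB | rewrite mulrBr ag subrr].
Qed.

(** Infiniteness of the residue field is expressed without forming the quotient:
    finitely many elements never represent all the classes modulo [M]. *)
Lemma residue_field_infinite M : infinite_set [set: R] -> artinian_ring R ->
  maximal_ideal M -> (forall M', maximal_ideal M' -> M = M') ->
  forall F : set R, finite_set F -> exists u, forall f, F f -> ~ M (u - f).
Proof.
move=> Rinf art Mmax Muniq F Ffin; apply: contrapT => nou.
have Frepr r : exists2 f, F f & M (r - f).
  apply: contrapT => nof; apply: nou; exists r => f Ff Mrf.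
  by apply: nof; exists f.
have [I [Iid Iinf Imin]] :=
  artinian_minimal_ideal (P := fun J => infinite_set J) art ideal_full Rinf.
have MI0 a x : M a -> I x -> a * x = 0.
  move=> Ma Ix.
  have aIid := ideal_scale a Iid.
  have aIfin : finite_set [set a * z | z in I].
    apply: contrapT => aIinf.
    have aII : [set a * z | z in I] = I.
      by apply: Imin => // _ [z Iz <-]; apply: idealM.
    have Ipow n z : I z -> exists z', z = a ^+ n * z'.
      elim: n z => [|n IHn] z; first by exists z; rewrite mul1r.
      rewrite -aII => -[w Iw <-]; have [z' ->] := IHn w Iw.
      by exists z'; rewrite exprS mulrA.
    have [n an0] := artinian_local_nilpotent art Mmax Muniq Ma.
    apply: Iinf; apply: sub_finite_set (finite_set1 0) => z Iz.
    by have [z' ->] := Ipow n z Iz; rewrite an0 mul0r.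
  suff Kx : [set z | I z /\ a * z = 0] x by case: Kx.
  rewrite (Imin [set z | I z /\ a * z = 0]) //.
  - exact: ideal_annihilated.
  - by move=> z [].
  - exact: infinite_annihilated.
have [x Ix x0] : exists2 x, I x & x <> 0.
  apply: contrapT => nox; apply: Iinf.
  apply: sub_finite_set (finite_set1 0) => z Iz.
  by apply: contrapT => z0; apply: nox; exists z.
have Rx_fin : finite_set [set x * r | r in setT].
  apply: sub_finite_set (finite_image (fun f => x * f) Ffin) => _ [r _ <-].
  have [f Ff Mrf] := Frepr r; exists f => //.
  by apply/esym/eqP; rewrite -subr_eq0 -mulrBr mulrC (MI0 _ _ Mrf Ix).
have [L [Lid _ Lx Lmax]] := exists_ideal_maximal_avoiding ideal_zero x0.
have LI_fin : finite_set (I `&` L).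
  apply: contrapT => LI_inf.
  have ILI : I `&` L = I by apply: Imin => //; exact: idealI.
  by apply: Lx; move: Ix; rewrite -ILI => -[].
apply: Iinf.
apply: sub_finite_set (finite_image2 (fun l z => l + z) LI_fin Rx_fin) => y Iy.
have [Ly|/Lmax[r Lr]] := pselect (L y).
  by exists y => //; exists 0; [exists 0; rewrite ?mulr0 | rewrite addr0].
have Mr : ~ M r.
  by move=> Mr; apply: Lx; move: Lr; rewrite (MI0 r y) // subr0.
have [v vr] := unit_outside_unique_maximal_ideal Muniq Mr.
exists (- v * (x - r * y)).
  split; apply: idealM => //; apply: idealB => //; exact: idealM.
exists (x * v); first by exists v.
have -> : - v * (x - r * y) + x * v = v * r * y by ring.
by rewrite vr mul1r.
Qed.

Lemma avoid_finitely_many_ideals M (T : eqType) (J : T -> set R) I (s : seq T) :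
  (forall F : set R, finite_set F -> exists u, forall f, F f -> ~ M (u - f)) ->
  (forall a, ~ M a -> exists v, v * a = 1) ->
  (forall k, is_ideal (J k)) -> is_ideal I -> (forall k, ~ I `<=` J k) ->
  exists2 x, I x & forall k, k \in s -> ~ J k x.
Proof.
move=> resid unitM Jid Iid IJ; elim: s => [|k0 s [x Ix Jx]].
  by exists 0 => //; exact: ideal0.
have [J0x|J0x] := pselect (J k0 x); last first.
  by exists x => // k; rewrite inE => /predU1P[->|/Jx].
have /existsNP[y /not_implyP[Iy J0y]] := IJ k0.
(* [b k] represents the residue class of [u] excluded by [J k], if any. *)
have /choice[b bP] (k : T) :
    exists b, forall u, J k (y + u * x) -> J k (y + b * x).
  have [[b Jb]|nob] := pselect (exists b, J k (y + b * x)); first by exists b.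
  by exists 0 => u Ju; case: nob; exists u.
have [u uP] := resid _ (finite_image b (finite_seq s)).
exists (y + u * x); first by apply: idealD => //; apply: idealM.
move=> k; rewrite inE => /predU1P[->|ks] Ju.
  apply: J0y; rewrite -[y](addrK (u * x)).
  by apply: idealB => //; apply: idealM.
have bs : (b @` [set` s]) (b k) by exists k.
have [v v1] := unitM _ (uP _ bs).
apply: (Jx k ks).
rewrite -[x]mul1r -v1.
have -> : v * (u - b k) * x = v * ((y + u * x) - (y + b k * x)) by ring.
by apply: idealM => //; apply: idealB => //; apply: bP Ju.
Qed.

End Ideals.

Theorem corollary2p25 (R : comNzRingType)
    (R_infinite : infinite_set [set: R]%classic)
    (R_artinian : artinian_ring R)
    (R_local : local_ring R) :
  u_ring R.
Proof.
have [M [Mmax Muniq]] := R_local.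
move=> I Iid n J Jid IJ; apply: contrapT => /forallNP noJ.
have [x Ix Jx] := avoid_finitely_many_ideals (enum 'I_n)
  (residue_field_infinite R_infinite R_artinian Mmax Muniq)
  (fun a => @unit_outside_unique_maximal_ideal R M a Muniq) Jid Iid noJ.
by have [k _ Jkx] := IJ x Ix; apply: (Jx k) => //; rewrite mem_enum.
Qed.
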